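(* Let $L,H>0$, let $p,\gamma\ge1$ be real numbers, and assume $\theta'_-(H)>\phi'_+(0)$. Then, for any $\lambda>0$, the function $g=0$ is not a local minimizer in $\mathrm{BV}((0,L))$ of the functional $$F(u)=\mathrm{TV}_{\phi,\theta}(u;(0,L))+\theta\bigl(|H-u^-(L)|\bigr)+\lambda\|u\|_p^\gamma$$ with boundary condition $u^+(0)=0$ (that is, among the functions $u\in\mathrm{BV}((0,L))$ satisfying $u^+(0)=0$).
   Context: Throughout, $\phi,\theta:[0,\infty)\to[0,\infty)$ are non-decreasing, $\phi$ is convex, $\theta$ is concave, $\phi(0)=\theta(0)=0$ and $\lim_{t\to\infty}\phi(t)/t=\lim_{t\to0^+}\theta(t)/t=1$. $\theta'_-(H)$ is the left derivative of $\theta$ at $H$ and $\phi'_+(0)$ the right derivative of $\phi$ at $0$. For a function $u$ of bounded variation on an open interval $I$, with derivative decomposed as $Du=u'\mathcal{L}^1+D^cu+D^ju$ (absolutely continuous, Cantor and jump parts), jump set $J_u$ and jumps $[u](x)=u^+(x)-u^-(x)$ (difference of right and left limits of a good representative), the nonlinear total variation is $$\mathrm{TV}_{\phi,\theta}(u;I)=\int_I\phi(|u'(x)|)\,dx+|D^cu|(I)+\sum_{x\in J_u}\theta(|[u](x)|).$$ $\|\cdot\|_p$ is the $L^p$ norm on $(0,L)$. Local minimality is with respect to the norm $\|u\|_{L^1}+|Du|((0,L))$ of $\mathrm{BV}((0,L))$. *)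

(* Defs.v *)
From HB Require Import structures.
From mathcomp Require Import all_boot all_order all_algebra.
From mathcomp Require Import all_classical all_reals all_analysis.

Set Implicit Arguments.
Unset Strict Implicit.
Unset Printing Implicit Defensive.

Import Order.TTheory GRing.Theory Num.Theory.
Import numFieldNormedType.Exports.

Local Open Scope ring_scope.
Local Open Scope classical_set_scope.

(* A term satisfying P if there is one, and the default x0 otherwise. *)
Definition pick_or (T : Type) (x0 : T) (P : T -> Prop) : T :=
  if pselect (exists x, P x) is left e then projT1 (cid e) else x0.

Section one_sided_derivatives.
Context {R : realType}.

Definition left_derivative (f : R -> R) (x : R) : R :=
  lim ((f (x + h) - f x) / h @[h --> 0^'-]).

Definition right_derivative (f : R -> R) (x : R) : R :=
  lim ((f (x + h) - f x) / h @[h --> 0^'+]).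

End one_sided_derivatives.

Section signed_measures.
Context {d : measure_display} {T : measurableType d} {R : realType}.
Variable nu : {charge set T -> \bar R}.

(* Hahn sets of nu; all that follows does not depend on their choice
   (Hahn_decomposition_uniq). *)
Definition hahn_pos : set T := projT1 (cid (Hahn_decomposition nu)).

Definition hahn_neg : set T :=
  projT1 (cid (projT2 (cid (Hahn_decomposition nu)))).

Definition hahnP : hahn_decomposition nu hahn_pos hahn_neg :=
  projT2 (cid (projT2 (cid (Hahn_decomposition nu)))).

(* the total variation |nu|(A) *)
Definition abs_charge (A : set T) : \bar R := charge_variation hahnP A.

Definition charge_integral (f : T -> R) : R :=
  \int[jordan_pos hahnP]_x f x - \int[jordan_neg hahnP]_x f x.

End signed_measures.

(* Functions of bounded variation on the open interval ]a, b[.  An element of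
   BV(]a, b[) is given by a representative u : R -> R, whose values outside
   ]a, b[ are irrelevant; a Radon measure on ]a, b[ of finite mass is a finite
   signed Borel measure on R which vanishes outside ]a, b[. *)
Section BV.
Context {R : realType}.
Variables a b : R.

Local Notation I := (`]a, b[%classic : set R).
Local Notation leb := (@lebesgue_measure R).
Local Notation charge := ({charge set (measurableTypeR R) -> \bar R})%type.

(* C^1 functions with compact support in ]a, b[ *)
Definition test_function (f : R -> R) : Prop :=
  [/\ forall x, derivable f x 1,
      continuous (derive1 f) &
      exists K : set R, [/\ compact K, K `<=` I & forall x, ~ K x -> f x = 0]].

Definition is_distributional_derivative (u : R -> R) (nu : charge) : Prop :=
  (forall A, measurable A -> nu A = nu (A `&` I)) /\
  (forall f, test_function f ->
    \int[leb]_(x in I) (u x * derive1 f x) = - charge_integral nu f).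

Definition BV : set (R -> R) :=
  [set u | leb.-integrable I (EFin \o u) /\
           exists nu : charge, is_distributional_derivative u nu].

(* The measure Du is unique; the value for u outside BV is irrelevant. *)
Definition D (u : R -> R) : charge :=
  pick_or (czero : charge) (is_distributional_derivative u).

Definition Lp_norm (p : R) (u : R -> R) : \bar R :=
  'N[leb]_p%:E[(EFin \o u) \_ I].

Definition BV_norm (u : R -> R) : \bar R := (Lp_norm 1 u + abs_charge (D u) I)%E.

(* pointwise variation on the open interval ]a, b[ *)
Definition pointwise_variation (v : R -> R) : \bar R :=
  ereal_sup [set e | exists s t : R,
    [/\ a < s, s <= t, t < b & e = total_variation s t v]].

(* Good representatives in the sense of Ambrosio, Fusco and Pallara: functions
   in the class of u whose pointwise variation is |Du|(I).  All of them have
   the same one-sided limits. *)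
Definition is_good_representative (u v : R -> R) : Prop :=
  {ae leb, forall x, I x -> v x = u x} /\
  pointwise_variation v = abs_charge (D u) I.

Definition good_representative (u : R -> R) : R -> R :=
  pick_or u (is_good_representative u).

(* u^+(x) and u^-(x): the limits from the right and from the left, which also
   make sense at x = a and at x = b respectively *)
Definition right_limit (u : R -> R) (x : R) : R :=
  lim (good_representative u y @[y --> x^'+]).

Definition left_limit (u : R -> R) (x : R) : R :=
  lim (good_representative u y @[y --> x^'-]).

Definition jump (u : R -> R) (x : R) : R := right_limit u x - left_limit u x.

Definition jump_set (u : R -> R) : set R := [set x | I x /\ jump u x != 0].

(* Du = v leb + C + J, where J is the restriction of Du to the (countable) jump
   set and C is singular and has no atoms; such a triple (v, C, J) is unique,
   v being determined up to a negligible set. *)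
Record is_BV_decomposition (u v : R -> R) (C J : charge) : Prop := {
  ac_integrable : leb.-integrable I (EFin \o v) ;
  jump_part : forall A, measurable A -> J A = D u (A `&` jump_set u) ;
  cantor_singular : exists N : set R,
    [/\ measurable N, leb N = 0%E &
        forall A, measurable A -> C A = C (A `&` N)] ;
  cantor_diffuse : forall x : R, C [set x] = 0%E ;
  decomposition : forall A, measurable A ->
    D u A = (\int[leb]_(x in A `&` I) (v x)%:E + C A + J A)%E }.

Definition BV_decomposition (u : R -> R) : (R -> R) * charge * charge :=
  pick_or (cst 0, czero : charge, czero : charge)
    (fun d => is_BV_decomposition u d.1.1 d.1.2 d.2).

Definition ac_density (u : R -> R) : R -> R := (BV_decomposition u).1.1.

Definition cantor_part (u : R -> R) : charge := (BV_decomposition u).1.2.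

Definition nonlinear_TV (phi theta : R -> R) (u : R -> R) : \bar R :=
  (\int[leb]_(x in I) (phi `|ac_density u x|)%:E
   + abs_charge (cantor_part u) I
   + \esum_(x in jump_set u) (theta `|jump u x|)%:E)%E.

(* g minimizes F among the elements of A in some BV-ball centred at g.
   The membership g \in A is not part of the predicate, so that its negation
   provides better competitors in A arbitrarily close to g. *)
Definition local_minimizer_BV (A : set (R -> R)) (F : (R -> R) -> \bar R)
    (g : R -> R) : Prop :=
  exists2 delta : R, 0 < delta &
    forall u, A u -> (BV_norm (u \- g)%R < delta%:E)%E -> (F g <= F u)%E.

End BV.

Definition penalized_TV {R : realType} (phi theta : R -> R)
    (L H p gamma lambda : R) (u : R -> R) : \bar R :=
  (nonlinear_TV 0 L phi theta u
   + (theta `|H - left_limit 0 L u L|)%:E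
   + lambda%:E * Lp_norm 0 L p u `^ gamma)%E.

(* Main.v *)
(* The competitor is the function u which vanishes on ]0, L - delta[ and then
   grows linearly with slope h up to the value e = h delta at L.  Compared with
   0, it lowers the boundary term by at least e theta'_-(H), by concavity, while
   it costs delta phi(h), which is e (phi'_+(0) + o(1)) as h -> 0, plus a
   penalization of at most lambda e delta^(1/p) as soon as e, delta <= 1.  Fixing
   delta small and then letting h -> 0 brings the BV norm of u to 0 and keeps
   F(u) < F(0).

   Since Du, the good representative of u and the decomposition of Du are
   obtained by choice, they have to be identified first.  Du is determined by
   testing against C^1 functions with compact support which converge pointwise
   to the indicator function of an open interval; the two other objects are
   then determined by Du. *)
Require Import Defs.
From HB Require Import structures.
From mathcomp Require Import all_boot all_order all_algebra.
From mathcomp Require Import all_classical all_reals all_analysis.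
From mathcomp Require Import measurable_realfun lra.

Set Implicit Arguments.
Unset Strict Implicit.
Unset Printing Implicit Defensive.

Import Order.TTheory GRing.Theory Num.Theory.
Import numFieldNormedType.Exports.

Local Open Scope ring_scope.
Local Open Scope classical_set_scope.

(** * Slopes of convex and concave functions *)

Lemma convex_functionP (R : realType) (f : R -> R) (A : set R) :
  convex_function (A : set R^o) f -> forall x y t, x \in A -> y \in A ->
  0 <= t <= 1 -> f (t * x + (1 - t) * y) <= t * f x + (1 - t) * f y.
Proof.
move=> cf x y t Ax Ay /andP[t0 t1].
exact: (cf (Itv01 t0 t1) x y Ax Ay).
Qed.

(** The point [h] is the convex combination of [k] and [0] with weight [h / k]. *)
Lemma convex_slope_nondecreasing (R : realType) (f : R -> R) (h k : R) :
  convex_function (`[0, +oo[%classic : set R^o) f -> f 0 = 0 ->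
  0 < h -> h <= k -> f h / h <= f k / k.
Proof.
move=> cf f0 h0 hk; have k0 : 0 < k by exact: lt_le_trans hk.
have := @convex_functionP R f _ cf k 0 (h / k).
rewrite !mulr0 addr0 f0 mulr0 addr0 divfK ?gt_eqF// => cfk.
rewrite ler_pdivrMr// mulrAC -mulrA mulrC; apply: cfk.
- by rewrite inE/= in_itv/= andbT ltW.
- by rewrite inE/= in_itv/= lexx.
- by rewrite divr_ge0 ?(ltW h0) ?(ltW k0)//= ler_pdivrMr// mul1r.
Qed.

(** [right_derivative] is a [lim], which carries information only once convergence is known. Here
    the quotients are monotone in [h] and bounded below by [0]. *)
Lemma cvg_right_derivative0 (R : realType) (f : R -> R) :
  convex_function (`[0, +oo[%classic : set R^o) f -> f 0 = 0 ->
  (forall t, 0 <= t -> 0 <= f t) ->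
  f h / h @[h --> 0^'+] --> right_derivative f 0.
Proof.
move=> cf f0 fge0; rewrite /right_derivative.
under [in X in _ --> X]eq_fun do rewrite add0r f0 subr0.
apply: nondecreasing_at_right_is_cvgr; near=> x.
  move=> h k; rewrite !in_itv/= => /andP[h0 _] _ hk.
  exact: convex_slope_nondecreasing.
exists 0 => _ [h /= + <-]; rewrite in_itv/= => /andP[h0 _].
by rewrite divr_ge0 ?fge0 ?ltW.
Unshelve. all: by end_near. Qed.

(** By concavity the backward quotient [q h] is nondecreasing in [h], so its limit at [0] is its
    infimum over []0, H[]. Monotonicity of [f] supplies the lower bound [0] that makes this infimum
    meaningful. *)
Lemma left_derivative_le (R : realType) (f : R -> R) (H e : R) :
  convex_function (`[0, +oo[%classic : set R^o) (\- f) ->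
  {in `[0, +oo[ &, nondecreasing_fun f} ->
  0 < e -> e < H -> left_derivative f H <= (f H - f (H - e)) / e.
Proof.
move=> cf ndf e0 eH; have H0 : 0 < H by exact: lt_trans eH.
have pos (t : R) : 0 <= t -> t \in `[0, +oo[%classic.
  by move=> t0; rewrite inE/= in_itv/= andbT.
pose q h := (f H - f (H - h)) / h.
have q_le h k : 0 < h -> h <= k -> k < H -> q h <= q k.
  move=> h0 hk kH; have k0 : 0 < k by exact: lt_le_trans hk.
  have := @convex_functionP R (\- f) _ cf (H - k) H (h / k).
  have -> : h / k * (H - k) + (1 - h / k) * H = H - h.
    have := divfK (lt0r_neq0 k0) h; move: (h / k) => t th.
    by rewrite -th; lra.
  move=> cfk; rewrite /q ler_pdivrMr// mulrAC -mulrA.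
  suff: - f (H - h) <= h / k * - f (H - k) + (1 - h / k) * - f H.
    by move: (h / k) => t ?; lra.
  apply: cfk.
  - by apply: pos; rewrite subr_ge0 ltW.
  - by apply: pos; rewrite ltW.
  - by rewrite divr_ge0 ?(ltW h0) ?(ltW k0)//= ler_pdivrMr// mul1r.
have q_ge0 (h : R) : 0 < h -> h < H -> 0 <= q h.
  move=> h0 hH; apply: divr_ge0; last exact: ltW.
  rewrite subr_ge0; apply: ndf; last by rewrite gerBl ltW.
    by apply: pos; rewrite subr_ge0 ltW.
  by apply: pos; exact: ltW.
have q_lb : has_lbound (q @` `]0, H[).
  exists 0 => _ [h /= + <-]; rewrite in_itv/= => /andP[h0 hH].
  exact: q_ge0.
have qcvg : q h @[h --> 0^'+] --> inf (q @` `]0, H[).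
  apply: (@nondecreasing_at_right_cvgr _ q 0 (BLeft H)) => //.
  move=> h k; rewrite !in_itv/= => /andP[h0 _] /andP[_ kH] hk.
  exact: q_le.
have -> : left_derivative f H = inf (q @` `]0, H[).
  apply/cvg_lim => //; apply/cvg_at_leftNP; rewrite oppr0.
  apply: cvg_trans qcvg; apply: near_eq_cvg; near=> h.
  by rewrite /q /= invrN mulrN -mulNr opprB.
by apply: ge_inf => //; exists e => //=; rewrite in_itv/= e0.
Unshelve. all: by end_near. Qed.

(** * Uniqueness of the distributional derivative *)

Lemma is_derive_sqr_max0 (R : realType) (y : R) :
  is_derive y 1 (fun z => Num.max z 0 ^+ 2) (2 * Num.max y 0).
Proof.
have cvg_slope : h^-1 *: (Num.max (h *: 1 + y) 0 ^+ 2 - Num.max y 0 ^+ 2)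
    @[h --> 0^'] --> 2 * Num.max y 0.
  apply/cvgrPdist_le => e e0; near=> h.
  have h0 : h != 0 by near: h; exact: nbhs_dnbhs_neq.
  (* The quotient misses the derivative by at most [|h|]. After multiplication by [|h|] this is a
     quadratic inequality, checked according to the signs of [y] and [h + y]. *)
  apply: (@le_trans _ _ `|h|); last first.
    by near: h; apply/dnbhs0_le.
  rewrite -(ler_pM2l (x := `|h|)) ?normr_gt0// -normrM -normrM.
  rewrite -[h%:A]/(h * 1) -[_ *: (_ - _)]/(_ * (_ - _)).
  rewrite mulr1 [X in `|X| <= _]mulrBr [h * (_ * (_ - _))]mulrA mulfV// mul1r.
  rewrite [`|h * h|]ger0_norm ?sqr_ge0// ler_norml !maxEle.
  by apply/andP; split; case: ifPn; case: ifPn; rewrite -?ltNge; nra.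
split; first by apply/cvg_ex; exists (2 * Num.max y 0).
exact/cvg_lim.
Unshelve. all: by end_near. Qed.

(** Squaring the positive part gives a C^1 function that vanishes for [y <= 0]. The map
    [m / (1 + m)] then keeps it between 0 and 1, with limit 1 at infinity. *)
Definition sigmoid {R : realType} (y : R) : R :=
  Num.max y 0 ^+ 2 / (1 + Num.max y 0 ^+ 2).

Definition dsigmoid {R : realType} (y : R) : R :=
  2 * Num.max y 0 / (1 + Num.max y 0 ^+ 2) ^+ 2.

Lemma is_derive_sigmoid (R : realType) (y : R) :
  is_derive y 1 sigmoid (dsigmoid y).
Proof.
have sq := is_derive_sqr_max0 y.
have n0 : 1 + Num.max y 0 ^+ 2 != 0 by rewrite gt_eqF// ltr_pwDl// sqr_ge0.
rewrite /sigmoid; apply: is_derive_eq.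
rewrite /GRing.scale/= /dsigmoid -exprVn.
have := divff n0; move: (Num.max y 0) => m.
move: (1 + m ^+ 2)^-1 => i mi.
have iE : i = i ^+ 2 * (1 + m ^+ 2) by rewrite expr2 -mulrA [i * (1 + _)]mulrC mi mulr1.
by rewrite [X in _ + X * _]iE; lra.
Qed.

Lemma continuous_dsigmoid (R : realType) : continuous (@dsigmoid R).
Proof.
move=> y; have cm : {for y, continuous (fun z : R => Num.max z 0)}.
  by apply: continuous_max => //; exact: cvg_cst.
have n0 : (1 + Num.max y 0 ^+ 2) ^+ 2 != 0.
  by rewrite gt_eqF// exprn_gt0// ltr_pwDl// sqr_ge0.
rewrite /dsigmoid; apply: cvgM; first by apply: cvgM => //; exact: cvg_cst.
apply: cvgV => //; rewrite !expr2.
by apply: cvgM; (apply: cvgD; [exact: cvg_cst|exact: cvgM]).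
Qed.

Lemma sigmoid_ge0_le1 (R : realType) (y : R) : 0 <= sigmoid y <= 1.
Proof.
have m0 : 0 < 1 + Num.max y 0 ^+ 2 by rewrite ltr_pwDl// sqr_ge0.
rewrite /sigmoid divr_ge0 ?sqr_ge0 ?(ltW m0)//= ler_pdivrMr// mul1r.
by rewrite lerDr.
Qed.

Lemma sigmoid_le0 (R : realType) (y : R) : y <= 0 -> sigmoid y = 0.
Proof. by move=> y0; rewrite /sigmoid max_r// expr0n mul0r. Qed.

Lemma cvg_sigmoid_pinfty (R : realType) : sigmoid y @[y --> +oo] --> (1 : R).
Proof.
apply/cvgrPdist_le => e e0; near=> y.
have y1 : 1 <= y by near: y; exact: nbhs_pinfty_ge.
have ye : e^-1 <= y by near: y; apply: nbhs_pinfty_ge; exact: num_real.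
have y0 : 0 <= y by exact: le_trans y1.
have d0 : 0 < 1 + y ^+ 2 by rewrite ltr_pwDl// sqr_ge0.
have -> : 1 - sigmoid y = (1 + y ^+ 2)^-1.
  rewrite /sigmoid max_l// -{1}(divff (lt0r_neq0 d0)) -mulrBl addrK mul1r//.
rewrite ger0_norm ?invr_ge0 ?(ltW d0)// -(invrK e) lef_pV2 ?posrE ?invr_gt0//.
by nra.
Unshelve. all: by end_near. Qed.

(* The shift by 1 makes the support, (x - s) (t - x) >= 1 / n, a compact subset
   of the open interval ]s, t[. *)
Definition bump {R : realType} (s t : R) (n : nat) (x : R) : R :=
  sigmoid (n%:R * ((x - s) * (t - x)) - 1).

Lemma is_derive_bump (R : realType) (s t : R) n (x : R) :
  is_derive x 1 (bump s t n)
    (dsigmoid (n%:R * ((x - s) * (t - x)) - 1) * (n%:R * (s + t - 2 * x))).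
Proof.
have := @is_derive_sigmoid R (n%:R * ((x - s) * (t - x)) - 1) => dsig.
apply: (@is_derive1_comp _ sigmoid (fun x => n%:R * ((x - s) * (t - x)) - 1)).
apply: is_derive_eq; rewrite /GRing.scale/=; lra.
Qed.

Lemma prod_gt0_itv (R : realType) (s t x : R) :
  s < t -> 0 < (x - s) * (t - x) -> s < x < t.
Proof.
move=> st xst; have [xs|sx] := leP x s; have [tx|xt] := leP t x => //; exfalso; nra.
Qed.

Lemma test_function_bump (R : realType) (a b s t : R) n :
  a <= s -> s < t -> t <= b -> test_function a b (bump s t n).
Proof.
move=> a_s st tb; have dbump x := is_derive_bump s t n x.
pose q x := n%:R * ((x - s) * (t - x)) - 1.
have cq : continuous q.
  move=> x; apply: cvgB; last exact: cvg_cst.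
  apply: cvgM; first exact: cvg_cst.
  by apply: cvgM; apply: cvgB => //; exact: cvg_cst.
split; first by move=> x; exact: (@ex_derive _ _ _ _ _ _ _ (dbump x)).
  have -> : derive1 (bump s t n) =
      fun x => dsigmoid (q x) * (n%:R * (s + t - 2 * x)).
    by apply/funext => x; rewrite derive1E; exact: derive_val.
  move=> x; apply: cvgM.
    by apply: continuous_comp; [exact: cq|exact: continuous_dsigmoid].
  apply: cvgM; first exact: cvg_cst.
  apply: cvgB; first exact: cvg_cst.
  by apply: cvgM => //; exact: cvg_cst.
(* The compact set is where [q] is nonnegative: closed by continuity and contained in [[s, t]]. For
   [n = 0] it is empty, since [q] is then constantly [-1]. *)
have Kst : q @^-1` [set y | 0 <= y] `<=` `]s, t[.
  move=> x; rewrite /q/= in_itv/= subr_ge0 => q0.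
  apply: prod_gt0_itv => //; rewrite -(pmulr_rgt0 (x := n%:R)).
    exact: lt_le_trans q0.
  rewrite lt0r ler0n andbT; apply: contraTN q0 => /eqP ->.
  by rewrite mul0r ler10.
exists (q @^-1` [set y | 0 <= y]); split.
- apply: (@subclosed_compact _ _ `[s, t]); last first.
  + by apply: subset_trans Kst _; exact: subset_itv_oo_cc.
  + exact: segment_compact.
  + by apply: (closed_comp (fun x _ => cq x)); exact: closed_ge.
- by apply: subset_trans Kst _; apply: subset_itvSoo; rewrite bnd_simp.
- move=> x /negP; rewrite -ltNge => qx.
  by apply: sigmoid_le0; exact: ltW.
Qed.

Lemma bump_ge0_le1 (R : realType) (s t : R) n x : 0 <= bump s t n x <= 1.
Proof. exact: sigmoid_ge0_le1. Qed.

(** Inside the interval the argument of [sigmoid] tends to infinity. Outside, it is negative for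
    every [n], so the sequence is identically zero. *)
Lemma cvg_bump_indic (R : realType) (s t : R) (x : R) : s < t ->
  bump s t n x @[n --> \oo] --> (\1_(`]s, t[%classic) x : R).
Proof.
move=> st; rewrite indicE.
have [|xst] := boolP (x \in _).
  rewrite inE/= in_itv/= => /andP[sx xt]; set q := (x - s) * (t - x).
  have q0 : 0 < q by rewrite mulr_gt0 ?subr_gt0.
  apply: (@cvg_comp _ _ _ (fun n => n%:R * q - 1) sigmoid _ +oo); last first.
    exact: cvg_sigmoid_pinfty.
  apply/cvgryPge => A; near=> n.
  rewrite lerBrDr -ler_pdivrMr//; near: n; exact: nbhs_infty_ger.
rewrite (_ : bump s t ^~ x = cst 0); first exact: cvg_cst.
apply/funext => n; apply: sigmoid_le0.
have : ~~ (0 < (x - s) * (t - x)).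
  by apply: contra xst => xst; rewrite inE/= in_itv/= prod_gt0_itv.
rewrite -leNgt subr_le0 => q0; apply: (@le_trans _ _ 0) => //.
by rewrite mulr_ge0_le0.
Unshelve. all: by end_near. Qed.

(** The bumps converge pointwise to the indicator of []s, t[] and are dominated by 1, which is
    integrable because the measures are finite. *)
Lemma finite_measure_test_itv (R : realType) (a b : R)
    (m1 m2 : {measure set (measurableTypeR R) -> \bar R}) (s t : R) :
  (m1 setT < +oo)%E -> (m2 setT < +oo)%E ->
  (forall f, test_function a b f -> (forall x, 0 <= f x <= 1) ->
    \int[m1]_x f x = \int[m2]_x f x) ->
  a <= s -> s < t -> t <= b -> m1 `]s, t[%classic = m2 `]s, t[%classic.
Proof.
move=> m1oo m2oo m12 a_s st tb.
have cbump n : continuous (bump s t n).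
  move=> x; apply: (@differentiable_continuous _ R^o R^o).
  by apply/derivable1_diffP; exact: (@ex_derive _ _ _ _ _ _ _ (is_derive_bump s t n x)).
have mbump n : measurable_fun (setT : set (measurableTypeR R)) (bump s t n).
  by apply: measurable_funTS; exact: continuous_measurable_fun.
have ibump (m : {measure set (measurableTypeR R) -> \bar R}) n :
    (m setT < +oo)%E -> m.-integrable setT (EFin \o bump s t n).
  move=> moo; apply: measurable_bounded_integrable => //.
  exists 1; split; first exact: num_real.
  move=> M M1 x _; have /andP[b0 b1] := bump_ge0_le1 s t n x.
  by rewrite /= ger0_norm// (le_trans b1)// ltW.
have cvg_int (m : {measure set (measurableTypeR R) -> \bar R}) :
    (m setT < +oo)%E ->
    (\int[m]_x (bump s t n x)%:E)%E @[n --> \oo] --> m `]s, t[%classic.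
  move=> moo.
  have -> : m `]s, t[%classic = (\int[m]_x (\1_(`]s, t[%classic) x)%:E)%E.
    by rewrite integral_indic// setIT.
  have [| | | | |//] := @dominated_convergence _ _ _ m setT measurableT
      (fun n x => (bump s t n x)%:E) (EFin \o \1_(`]s, t[%classic)) (cst 1%E).
  - by move=> n; exact/measurable_EFinP.
  - exact/measurable_EFinP/measurable_indic.
  - apply: aeW => x _; apply: cvg_EFin; first exact: nearW.
    exact: cvg_bump_indic.
  - apply: (@measurable_bounded_integrable _ _ _ m (cst 1)) => //.
    by exists 1; split; rewrite ?num_real// => M M1 x _; rewrite /= normr1 ltW.
  - apply: aeW => x n _; have /andP[b0 b1] := bump_ge0_le1 s t n x.
    by rewrite /= lee_fin ger0_norm.
(* The hypothesis equates real integrals only, that is, images under [fine]; finiteness lifts the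
   equality to extended reals. *)
have eq_int n : (\int[m1]_x (bump s t n x)%:E = \int[m2]_x (bump s t n x)%:E)%E.
  rewrite -[LHS]fineK ?(integrable_fin_num measurableT (ibump _ _ m1oo))//.
  rewrite -[RHS]fineK ?(integrable_fin_num measurableT (ibump _ _ m2oo))//.
  congr EFin; apply: m12; first exact: test_function_bump.
  exact: bump_ge0_le1.
have := cvg_int _ m1oo; under eq_fun do rewrite eq_int.
by move/cvg_lim => <- //; apply: cvg_lim => //; exact: cvg_int.
Qed.

(** Open rays are stable under intersection and generate the Borel sets. Since both measures live on
    []a, b[], a ray counts only through an open subinterval, possibly empty. *)
Lemma finite_measure_test_unique (R : realType) (a b : R)
    (m1 m2 : {measure set (measurableTypeR R) -> \bar R}) :
  (m1 setT < +oo)%E -> (m2 setT < +oo)%E ->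
  (forall A, measurable A -> m1 A = m1 (A `&` `]a, b[)) ->
  (forall A, measurable A -> m2 A = m2 (A `&` `]a, b[)) ->
  (forall f, test_function a b f -> (forall x, 0 <= f x <= 1) ->
    \int[m1]_x f x = \int[m2]_x f x) ->
  forall A, measurable A -> m1 A = m2 A.
Proof.
move=> m1oo m2oo m1I m2I m12.
have mG : (measurable : set (set (measurableTypeR R))) = <<s @RGenOInfty.G R >>.
  exact: RGenOInfty.measurableE.
move=> A mA; apply: (@measure_unique _ R (measurableTypeR R) (@RGenOInfty.G R)
  (fun n => `](- n%:R : R), +oo[%classic) mG _ _ _ m1 m2 _ _ A mA).
- move=> _ _ [x ->] [y ->]; exists (Num.max x y).
  by apply/seteqP; split => z /=; rewrite !in_itv/= !andbT gt_max => /andP.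
- by move=> n; exists (- n%:R).
- rewrite -subTset => x _; 
  exists (Num.truncn `|x|).+1 => //=.
  rewrite in_itv/= andbT ltrNl (le_lt_trans (ler_norm _))// normrN.
  exact: truncnS_gt.
- move=> _ [x ->]; rewrite m1I// m2I//.
  have -> : `]x, +oo[ `&` `]a, b[ = `]Num.max x a, b[%classic.
    apply/seteqP; split => z /=; rewrite !in_itv/= andbT gt_max.
      by move=> [-> /andP[-> ->]].
    by move=> /andP[/andP[-> ->] ->].
  have [xab|bxa] := ltP (Num.max x a) b.
    by apply: (finite_measure_test_itv m1oo m2oo m12) => //; rewrite le_max lexx orbT.
  by rewrite set_itv_ge ?measure0// bnd_simp -leNgt.
- by move=> n; apply: le_lt_trans m1oo; apply: le_measure; rewrite ?inE.
Qed.

Lemma jordan_pos_cap (R : realType) d (T : measurableType d)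
   (nu : {charge set T -> \bar R}) (I : set T) (P N : set T)
   (nuPN : hahn_decomposition nu P N) :
  measurable I -> (forall A, measurable A -> nu A = nu (A `&` I)) ->
  forall A, measurable A -> jordan_pos nuPN A = jordan_pos nuPN (A `&` I).
Proof.
move=> mI nuI A mA; have [[mP _] _ _ _] := nuPN.
rewrite !jordan_posE !cjordan_posE /crestr0 !mem_set//; last exact: measurableI.
by rewrite /crestr [in RHS]setIAC; apply: nuI; exact: measurableI.
Qed.

Lemma jordan_neg_cap (R : realType) d (T : measurableType d)
   (nu : {charge set T -> \bar R}) (I : set T) (P N : set T)
   (nuPN : hahn_decomposition nu P N) :
  measurable I -> (forall A, measurable A -> nu A = nu (A `&` I)) ->
  forall A, measurable A -> jordan_neg nuPN A = jordan_neg nuPN (A `&` I).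
Proof.
move=> mI nuI A mA; have [_ [mN _] _ _] := nuPN.
rewrite !jordan_negE !cjordan_negE /crestr0 !mem_set//; last exact: measurableI.
by rewrite /crestr [in RHS]setIAC; congr -%E; apply: nuI; exact: measurableI.
Qed.

(** With Jordan parts [p1 - n1] and [p2 - n2], the claim is equivalent to [p1 + n2 = p2 + n1]. These
    are finite positive measures, to which the previous uniqueness result applies. *)
Lemma distributional_derivative_unique (R : realType) (a b : R) (u : R -> R)
    (nu1 nu2 : {charge set (measurableTypeR R) -> \bar R}) :
  is_distributional_derivative a b u nu1 ->
  is_distributional_derivative a b u nu2 ->
  forall A, measurable A -> nu1 A = nu2 A.
Proof.
move=> [nu1I nu1E] [nu2I nu2E] A mA.
pose p1 : {finite_measure set _ -> \bar R} := jordan_pos (hahnP nu1).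
pose n1 : {finite_measure set _ -> \bar R} := jordan_neg (hahnP nu1).
pose p2 : {finite_measure set _ -> \bar R} := jordan_pos (hahnP nu2).
pose n2 : {finite_measure set _ -> \bar R} := jordan_neg (hahnP nu2).
have mI : measurable (`]a, b[%classic : set (measurableTypeR R)) by [].
pose m1 : {measure set _ -> \bar R} := measure_add p1 n2.
pose m2 : {measure set _ -> \bar R} := measure_add p2 n1.
have m1E B : (m1 B = p1 B + n2 B)%E by exact: measure_addE.
have m2E B : (m2 B = p2 B + n1 B)%E by exact: measure_addE.
have : m1 A = m2 A.
  apply: (@finite_measure_test_unique R a b m1 m2) => //.
  - by rewrite m1E lte_add_pinfty// ltey_eq fin_num_measure.
  - by rewrite m2E lte_add_pinfty// ltey_eq fin_num_measure.
  - move=> B mB; rewrite !m1E; congr (_ + _)%E.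
      exact: (jordan_pos_cap (hahnP nu1) mI nu1I mB).
    exact: (jordan_neg_cap (hahnP nu2) mI nu2I mB).
  - move=> B mB; rewrite !m2E; congr (_ + _)%E.
      exact: (jordan_pos_cap (hahnP nu2) mI nu2I mB).
    exact: (jordan_neg_cap (hahnP nu1) mI nu1I mB).
  move=> f tf f01.
  have mf : measurable_fun (setT : set (measurableTypeR R)) f.
    apply: measurable_funTS; apply: continuous_measurable_fun => x.
    apply: (@differentiable_continuous _ R^o R^o).
    by apply/derivable1_diffP; case: tf.
  have int_f (m : {finite_measure set (measurableTypeR R) -> \bar R}) :
      m.-integrable setT (EFin \o f).
    apply: measurable_bounded_integrable => //.
      by rewrite ltey_eq fin_num_measure.
    exists 1; split; first exact: num_real.
    move=> M M1 x _; have /andP[f0 f1] := f01 x.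
    by rewrite /= ger0_norm// (le_trans f1)// ltW.
  have RintD (m n : {finite_measure set (measurableTypeR R) -> \bar R}) :
      \int[measure_add m n]_x f x = \int[m]_x f x + \int[n]_x f x.
    rewrite /Rintegral integral_measure_add//; [|exact: int_f|exact: int_f].
    rewrite fineD//; [apply: (integrable_fin_num measurableT (int_f m))|].
    exact: (integrable_fin_num measurableT (int_f n)).
  rewrite /m1 /m2 !RintD.
  have := nu1E _ tf; rewrite (nu2E _ tf) => /oppr_inj.
  rewrite /charge_integral -/p1 -/p2 -/n1 -/n2.
  lra.
rewrite m1E m2E (jordan_decomp (hahnP nu1) mA) (jordan_decomp (hahnP nu2) mA).
rewrite /cadd/= !cscaleN1.
have aux (x1 x2 y1 y2 : \bar R) : x1 \is a fin_num -> x2 \is a fin_num ->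
    y1 \is a fin_num -> y2 \is a fin_num ->
    (x1 + y2 = x2 + y1 -> x1 - y1 = x2 - y2)%E.
  case: x1 x2 y1 y2 => [x1| |] [x2| |] [y1| |] [y2| |]//= _ _ _ _ [xy].
  by congr EFin; lra.
by apply: aux; exact: fin_num_measure.
Qed.

(** * Nonnegative charges *)

Lemma jordan_neg_eq0 (R : realType) d (T : measurableType d)
    (nu : {charge set T -> \bar R}) (P N : set T)
    (nuPN : hahn_decomposition nu P N) :
  (forall A, measurable A -> 0 <= nu A)%E ->
  forall A, measurable A -> jordan_neg nuPN A = 0%E.
Proof.
move=> nu0 A mA; have [_ [mN _] _ _] := nuPN.
apply/eqP; rewrite eq_le measure_ge0 andbT.
rewrite jordan_negE cjordan_negE /crestr0 mem_set// leeNl oppe0.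
by apply: nu0; exact: measurableI.
Qed.

Lemma jordan_pos_eq (R : realType) d (T : measurableType d)
    (nu : {charge set T -> \bar R}) (P N : set T)
    (nuPN : hahn_decomposition nu P N) :
  (forall A, measurable A -> 0 <= nu A)%E ->
  forall A, measurable A -> jordan_pos nuPN A = nu A.
Proof.
move=> nu0 A mA; rewrite (jordan_decomp nuPN mA) /cadd/= cscaleN1.
transitivity (jordan_pos nuPN A - 0)%E; first by rewrite oppe0 adde0.
by congr (_ - _)%E; apply/esym; exact: jordan_neg_eq0.
Qed.

Lemma abs_charge_nonneg (R : realType) d (T : measurableType d)
    (nu : {charge set T -> \bar R}) :
  (forall A, measurable A -> 0 <= nu A)%E ->
  forall A, measurable A -> abs_charge nu A = nu A.
Proof.
move=> nu0 A mA; rewrite /abs_charge /charge_variation/= -[RHS]adde0.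
by congr (_ + _)%E; [exact: jordan_pos_eq|exact: jordan_neg_eq0].
Qed.

Lemma charge_integral_measure (R : realType) d (T : measurableType d)
    (nu : {charge set T -> \bar R}) (m : {measure set T -> \bar R})
    (f : T -> R) :
  (forall A, measurable A -> nu A = m A) ->
  charge_integral nu f = \int[m]_x f x.
Proof.
move=> num; have nu0 A : measurable A -> (0 <= nu A)%E by move=> mA; rewrite num.
rewrite /charge_integral.
have -> : \int[jordan_neg (hahnP nu)]_x f x = 0.
  rewrite /Rintegral (@eq_measure_integral _ _ _ _ mzero).
    by rewrite integral_measure_zero.
  by move=> A mA _; exact: jordan_neg_eq0.
rewrite subr0; congr fine; apply: eq_measure_integral => A mA _.
by rewrite -num//; exact: jordan_pos_eq.
Qed.

(** The space is split into [S], where the restricted measure agrees with [mu], and its complement,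
    where it is zero. *)
Lemma ge0_integral_mrestr (R : realType) d (T : measurableType d)
    (mu : {measure set T -> \bar R}) (S : set T) (mS : measurable S)
    (f : T -> \bar R) :
  measurable_fun setT f -> (forall x, 0 <= f x)%E ->
  (\int[mrestr mu mS]_x f x = \int[mu]_(x in S) f x)%E.
Proof.
move=> mf f0; have mSC : measurable (~` S) by exact: measurableC.
rewrite -(setUCr S) ge0_integral_setU//=; last 2 first.
  by rewrite setUCr.
  by apply/disj_set2P; rewrite setICr.
rewrite (@eq_measure_integral _ _ _ S mu); last first.
  by move=> A mA AS; rewrite /= /mrestr setIidl.
rewrite [X in (_ + X)%E](@eq_measure_integral _ _ _ _ mzero).
  by rewrite integral_measure_zero adde0.
move=> A mA AS; rewrite /= /mrestr (_ : A `&` S = set0) ?measure0//.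
by apply/seteqP; split => // x [/AS].
Qed.

Lemma Rintegral_mscale_mrestr (R : realType) d (T : measurableType d)
    (mu : {measure set T -> \bar R}) (S : set T) (mS : measurable S)
    (k : {nonneg R}) (f : T -> R) :
  measurable_fun setT f -> mu.-integrable S (EFin \o f) ->
  \int[mscale k (mrestr mu mS)]_x f x = k%:num * \int[mu]_(x in S) f x.
Proof.
move=> /measurable_EFinP mf intf; rewrite /Rintegral integralE.
have mp := measurable_funepos mf; have mn := measurable_funeneg mf.
rewrite !ge0_integral_mscale// !ge0_integral_mrestr//.
rewrite -muleBr//; last exact: integrable_add_def.
rewrite -integralE fineM//.
exact: integrable_fin_num.
Qed.

(** * Ramp functions *)

(** The competitor is [ramp h (L - delta)], and the zero function is [ramp 0 0]; the lemmas below
    thus serve both sides of the comparison. *)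
Definition ramp {R : realType} (c s x : R) : R := c * Num.max (x - s) 0.

Lemma continuous_ramp (R : realType) (c s : R) : continuous (ramp c s).
Proof.
move=> x; apply: cvgM; first exact: cvg_cst.
have : {for x, continuous (fun z : R => Num.max (z - s) 0)}; last exact.
by apply: continuous_max; [apply: cvgB => //|]; exact: cvg_cst.
Qed.

Lemma ramp_le (R : realType) (c s x : R) : x <= s -> ramp c s x = 0.
Proof. by move=> xs; rewrite /ramp max_r ?mulr0// subr_le0. Qed.

Lemma ramp_ge (R : realType) (c s x : R) : s <= x -> ramp c s x = c * (x - s).
Proof. by move=> sx; rewrite /ramp max_l// subr_ge0. Qed.

(** Cutting Lebesgue measure to []s, b[] makes its mass finite, as a charge requires. *)
Lemma ramp_charge (R : realType) (c s b : R) :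
  exists nu : {charge set (measurableTypeR R) -> \bar R},
    forall A, measurable A ->
      nu A = (c%:E * (@lebesgue_measure R) (A `&` `]s, b[))%E.
Proof.
have mS : measurable (`]s, b[%classic : set (measurableTypeR R)) by [].
have Soo : ((@lebesgue_measure R) `]s, b[%classic < +oo)%E.
  by rewrite lebesgue_measure_itv/=; case: ifPn => // _; rewrite -EFinB ltry.
by exists (cscale c (charge_of_finite_measure (mfrestr mS Soo))) => A mA.
Qed.

Lemma ramp_distributional_derivative (R : realType) (a b c s : R)
    (nu : {charge set (measurableTypeR R) -> \bar R}) :
  0 <= c -> a <= s -> s < b ->
  (forall A, measurable A ->
    nu A = (c%:E * (@lebesgue_measure R) (A `&` `]s, b[))%E) ->
  is_distributional_derivative a b (ramp c s) nu.
Proof.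
move=> c0 a_s sb nuE.
have mS : measurable (`]s, b[%classic : set (measurableTypeR R)) by [].
have SI : `]s, b[ `<=` `]a, b[%classic by apply: subset_itvr; rewrite bnd_simp.
split=> [A mA|f [df cdf [K [cK KI f0]]]].
  rewrite !nuE//; last exact: measurableI.
  by rewrite -setIA (setIidr SI).
have cf : continuous f.
  by move=> x; apply/(@differentiable_continuous _ R^o R^o)/derivable1_diffP.
have intf (g : R -> R) : continuous g ->
    (@lebesgue_measure R).-integrable `[s, b] (EFin \o g).
  move=> cg; apply: continuous_compact_integrable; first exact: segment_compact.
  exact: continuous_subspaceT.
have intfS (g : R -> R) : continuous g ->
    (@lebesgue_measure R).-integrable `]s, b[ (EFin \o g).
  move=> cg; apply: integrableS (intf _ cg) => //.
  exact: subset_itv_oo_cc.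
have -> : charge_integral nu f = c * \int[@lebesgue_measure R]_(x in `]s, b[) f x.
  rewrite (@charge_integral_measure _ _ _ _
    (mscale (NngNum c0) (mrestr (@lebesgue_measure R) mS))).
    rewrite Rintegral_mscale_mrestr//=; first exact: continuous_measurable_fun.
    exact: intfS.
  by move=> A mA; rewrite nuE.
have crdf : continuous (fun x => ramp c s x * derive1 f x).
  by move=> x; apply: cvgM; [exact: continuous_ramp|exact: cdf].
have oo_cc (g : R -> R) : continuous g ->
    \int[@lebesgue_measure R]_(x in `]s, b[) g x =
    \int[@lebesgue_measure R]_(x in `[s, b]) g x.
  move=> cg; rewrite Rintegral_itv_bndo_bndc; last exact: intfS.
  rewrite Rintegral_itv_obnd_cbnd//; apply: integrableS (intf _ cg) => //.
  exact: subset_itv_oc_cc.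
(* The ramp vanishes up to [s]. On the rest it is affine, and passing to the closed interval
   [[s, b]] prepares the integration by parts. *)
transitivity (\int[@lebesgue_measure R]_(x in `]s, b[) (ramp c s x * derive1 f x)).
  rewrite -[in RHS](setIidl SI) Rintegral_mkcondl.
  apply: eq_Rintegral => x; rewrite inE/= in_itv/= => /andP[_ xb].
  rewrite patchE; case: ifPn => // xS.
  rewrite ramp_le ?mul0r// leNgt; apply: contra xS => sx.
  by rewrite inE/= in_itv/= sx.
rewrite oo_cc// oo_cc//.
transitivity (\int[@lebesgue_measure R]_(x in `[s, b]) (c * (x - s) * derive1 f x)).
  apply: eq_Rintegral => x; rewrite inE/= in_itv/= => /andP[sx _].
  by rewrite ramp_ge.
have daff (x : R) : is_derive x 1 (fun y : R => c * (y - s)) c.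
  by apply: is_derive_eq; rewrite /GRing.scale/=; lra.
have LR (g : R -> R) : (forall x, derivable g x 1) ->
    derivable_oo_LRcontinuous g s b.
  move=> dg; have cg : continuous g.
    by move=> x; apply/(@differentiable_continuous _ R^o R^o)/derivable1_diffP.
  by split=> //; [apply: cvg_at_right_filter|apply: cvg_at_left_filter]; exact: cg.
(* Both boundary terms vanish: the affine factor at [s], and [f] at [b], which lies outside its
   support. *)
rewrite (@Rintegration_by_parts _ (fun y => c * (y - s)) f (cst c)) => //.
- rewrite subrr mulr0 mul0r subr0 f0; last first.
    by move/KI; rewrite /= in_itv/= ltxx andbF.
  rewrite mulr0 sub0r RintegralZl//; exact: intf.
- by apply: continuous_subspaceT => x; exact: cvg_cst.
- by apply: LR => x; exact: (@ex_derive _ _ _ _ _ _ _ (daff x)).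
- by move=> x _; rewrite derive1E; exact: derive_val.
- exact: continuous_subspaceT.
- exact: LR.
Qed.

(** [D] is obtained by choice: the explicit charge rules out the default, and uniqueness identifies
    the chosen one on measurable sets. *)
Lemma D_ramp (R : realType) (a b c s : R) : 0 <= c -> a <= s -> s < b ->
  forall A, measurable A ->
    D a b (ramp c s) A = (c%:E * (@lebesgue_measure R) (A `&` `]s, b[))%E.
Proof.
move=> c0 a_s sb A mA; have [nu nuE] := ramp_charge c s b.
have dnu := ramp_distributional_derivative c0 a_s sb nuE.
rewrite -nuE//; apply: (distributional_derivative_unique _ dnu mA).
rewrite /D /pick_or; case: pselect => [e|]; first exact: (projT2 (cid e)).
by case; exists nu.
Qed.

Lemma BV_ramp (R : realType) (a b c s : R) : 0 <= c -> a <= s -> s < b ->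
  BV a b (ramp c s).
Proof.
move=> c0 a_s sb; split; last first.
  have [nu nuE] := ramp_charge c s b.
  by exists nu; exact: ramp_distributional_derivative.
have : (@lebesgue_measure R).-integrable `[a, b] (EFin \o ramp c s).
  apply: continuous_compact_integrable; first exact: segment_compact.
  by apply: continuous_subspaceT; exact: continuous_ramp.
by apply: integrableS => //; exact: subset_itv_oo_cc.
Qed.

Lemma abs_charge_D_ramp (R : realType) (a b c s : R) :
  0 <= c -> a <= s -> s < b ->
  abs_charge (D a b (ramp c s)) `]a, b[ = (c * (b - s))%:E.
Proof.
move=> c0 a_s sb; rewrite abs_charge_nonneg//; last first.
  by move=> A mA; rewrite D_ramp// mule_ge0.
rewrite D_ramp//.
have SI : `]s, b[ `<=` `]a, b[%classic by apply: subset_itvr; rewrite bnd_simp.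
by rewrite (setIidr SI) lebesgue_measure_itv/= lte_fin sb -EFinB.
Qed.

(** * Good representative and one-sided limits of a ramp *)

Lemma ae_itv_dense (R : realType) (P : R -> Prop) (y z : R) : y < z ->
  {ae @lebesgue_measure R, forall x, y < x < z -> P x} ->
  exists2 x, y < x < z & P x.
Proof.
move=> yz [N [mN N0 PN]]; apply: contrapT => nP.
have yzN : `]y, z[ `<=` N.
  move=> x /=; rewrite in_itv/= => yxz; apply: PN => /(_ yxz) Px.
  by apply: nP; exists x.
have : ((@lebesgue_measure R) `]y, z[%classic <= 0)%E.
  by rewrite -N0; apply: le_measure; rewrite ?inE.
by rewrite lebesgue_measure_itv/= lte_fin yz -EFinB lee_fin subr_le0 leNgt yz.
Qed.

Lemma ramp_nondecreasing_lipschitz (R : realType) (c s x y : R) : 0 <= c ->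
  x <= y -> ramp c s x <= ramp c s y <= ramp c s x + c * (y - x).
Proof.
move=> c0 xy; rewrite /ramp -mulrDr !ler_wpM2l//=.
  by have [?|?] := leP (y - s) 0; have [?|?] := leP (x - s) 0; lra.
by have [?|?] := leP (y - s) 0; have [?|?] := leP (x - s) 0; lra.
Qed.

(** One-sided limits are sensitive to values on null sets, so almost everywhere equality is not
    enough. Minimality of the variation forces equality at each interior point. *)
Lemma good_representative_ramp (R : realType) (a b c s x : R) :
  0 <= c -> a <= s -> s < b -> a < x < b ->
  good_representative a b (ramp c s) x = ramp c s x.
Proof.
move=> c0 a_s sb /andP[ax xb]; rewrite /good_representative /pick_or.
(* Without a good representative the default value is the ramp itself, and the claim is
   immediate. *)
case: pselect => // ex; case: (cid ex) => v /= [vu TVv].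
have {vu}vu : {ae @lebesgue_measure R, forall y, a < y < b -> v y = ramp c s y}.
  apply: (@filterS _ _ (ae_filter_ringOfSetsType _) _ _ _ vu) => y + ayb.
  by apply; rewrite /= in_itv.
rewrite abs_charge_D_ramp// in TVv.
have dense y z : a <= y -> y < z -> z <= b ->
    exists2 w, y < w < z & v w = ramp c s w.
  move=> ay yz zb; apply: ae_itv_dense => //.
  apply: (@filterS _ _ (ae_filter_ringOfSetsType _) _ _ _ vu) => w + /andP[yw wz].
  apply.
  by rewrite (le_lt_trans ay)// (lt_le_trans wz).
(* If v differs from the ramp at x by d, then passing through x adds about 2 d to
   the variation c (b - s) of the ramp, which v already attains at the points
   of a dense set. *)
apply/eqP; apply: contrapT => /negP vx.
pose d := `|v x - ramp c s x|; have d0 : 0 < d by rewrite normr_gt0 subr_eq0.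
(* The sum over [p < y < x < z < q] is at least [c (b - s) + 2 d - 6 c e]: each of the two detours
   to [v x] loses [c e], and four more such terms come from replacing [p], [y], [z], [q] by [a],
   [x], [x], [b]. Hence [3 c e < d] is required; the [+ 1] makes it strict and covers [c = 0]. The
   halves keep the points in order. *)
pose e := Num.min (d / (3 * c + 1)) (Num.min ((x - a) / 2) ((b - x) / 2)).
have c1 : 0 < 3 * c + 1 by lra.
have e0 : 0 < e by rewrite !lt_min !divr_gt0 ?subr_gt0.
have ed : 3 * (c * e) < d.
  have : e * (3 * c + 1) <= d.
    by rewrite -ler_pdivlMr// /e ge_min lexx.
  lra.
have ea : a + e <= x - e.
  have : e <= (x - a) / 2 by rewrite /e !ge_min lexx orbT.
  lra.
have eb : x + e <= b - e.
  have : e <= (b - x) / 2 by rewrite /e !ge_min lexx !orbT.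
  lra.
have [p /andP[ap pe] vp] := dense a (a + e) (lexx _) ltac:(lra) ltac:(lra).
have [y /andP[ey yx] vy] := dense (x - e) x ltac:(lra) ltac:(lra) ltac:(lra).
have [z /andP[xz ze] vz] := dense x (x + e) ltac:(lra) ltac:(lra) ltac:(lra).
have [q /andP[eq qb] vq] := dense (b - e) b ltac:(lra) ltac:(lra) ltac:(lra).
have : (total_variation p q v <= (c * (b - s))%:E)%E.
  by rewrite -TVv; apply: ereal_sup_ubound; exists p, q; split => //; lra.
rewrite (@total_variationD _ p q y); [|lra..].
rewrite (@total_variationD _ y q x); [|lra..].
rewrite (@total_variationD _ x q z); [|lra..].
have tv g h : g <= h -> (`|v h - v g|%:E <= total_variation g h v)%E.
  exact: total_variation_ge.
apply/negP; rewrite -ltNge.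
apply: (@lt_le_trans _ _ ((`|v y - v p| +
    (`|v x - v y| + (`|v z - v x| + `|v q - v z|)))%:E)); last first.
  by rewrite !EFinD; repeat apply: leeD; apply: tv; lra.
rewrite lte_fin vp vy vz vq.
have lip g h : g <= h -> ramp c s g <= ramp c s h <= ramp c s g + c * (h - g).
  exact: ramp_nondecreasing_lipschitz.
have ub : ramp c s b = c * (b - s) by rewrite ramp_ge// ltW.
have ua : ramp c s a = 0 by rewrite ramp_le.
have ce g : g <= e -> c * g <= c * e by exact: ler_wpM2l.
have /andP[_ rp] := lip a p (ltW ap).
have {}rp := le_trans rp (lerD (lexx _) (ce (p - a) ltac:(lra))).
have /andP[_ rq] := lip q b (ltW qb).
have {}rq := le_trans rq (lerD (lexx _) (ce (b - q) ltac:(lra))).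
have /andP[ryx rx] := lip y x (ltW yx).
have {}rx := le_trans rx (lerD (lexx _) (ce (x - y) ltac:(lra))).
have /andP[rxz rz] := lip x z (ltW xz).
have {}rz := le_trans rz (lerD (lexx _) (ce (z - x) ltac:(lra))).
have dy := ler_distD (ramp c s y) (v x) (ramp c s x).
have dz := ler_distD (ramp c s z) (v x) (ramp c s x).
rewrite [`|ramp c s y - _|]distrC [`|ramp c s x - _|]ger0_norm ?subr_ge0// -/d in dy.
rewrite [`|v x - ramp c s z|]distrC [`|ramp c s z - ramp c s x|]ger0_norm
  ?subr_ge0// -/d in dz.
have := ler_norm (ramp c s y - ramp c s p).
have := ler_norm (ramp c s q - ramp c s z).
rewrite ub in rq; rewrite ua in rp.
move: (`|ramp c s y - _|) (`|ramp c s q - _|) (`|ramp c s z - _|) (`|v x - _|)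
  dy dz ed => A B C E.
clearbody d; lra.
Qed.

(** Only points of []x, b[] matter, so [x = a] is allowed: this yields the boundary condition at
    [0]. Symmetrically, [left_limit_ramp] reaches the endpoint [b] and yields the value at [L]. *)
Lemma right_limit_ramp (R : realType) (a b c s x : R) :
  0 <= c -> a <= s -> s < b -> a <= x < b ->
  right_limit a b (ramp c s) x = ramp c s x.
Proof.
move=> c0 a_s sb /andP[ax xb]; apply/cvg_lim => //.
have cr : ramp c s y @[y --> x^'+] --> ramp c s x.
  by apply: cvg_at_right_filter; exact: continuous_ramp.
apply: cvg_trans cr; apply: near_eq_cvg; near=> y.
rewrite good_representative_ramp//; apply/andP; split.
  by apply: (le_lt_trans ax); near: y; exact: nbhs_right_gt.
by near: y; exact: nbhs_right_lt.
Unshelve. all: by end_near. Qed.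

Lemma left_limit_ramp (R : realType) (a b c s x : R) :
  0 <= c -> a <= s -> s < b -> a < x <= b ->
  left_limit a b (ramp c s) x = ramp c s x.
Proof.
move=> c0 a_s sb /andP[ax xb]; apply/cvg_lim => //.
have cr : ramp c s y @[y --> x^'-] --> ramp c s x.
  by apply: cvg_at_left_filter; exact: continuous_ramp.
apply: cvg_trans cr; apply: near_eq_cvg; near=> y.
rewrite good_representative_ramp//; apply/andP; split.
  by near: y; exact: nbhs_left_gt.
by rewrite (lt_le_trans _ xb)//; near: y; exact: nbhs_left_lt.
Unshelve. all: by end_near. Qed.

(** * Decomposition of the derivative of a ramp, and the cost of a ramp *)

Lemma jump_set_ramp (R : realType) (a b c s : R) :
  0 <= c -> a <= s -> s < b -> jump_set a b (ramp c s) = set0.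
Proof.
move=> c0 a_s sb; apply/seteqP; split => // x [].
rewrite /= in_itv/= => /andP[ax xb]; rewrite /jump right_limit_ramp//; last first.
  by rewrite (ltW ax).
by rewrite left_limit_ramp ?subrr ?eqxx// ax ltW.
Qed.

(** [J] vanishes because there are no jumps. [C] is carried by a null set, on whose subsets both [D]
    and the integral of [v] are zero, so [C] vanishes too. Then [v] and the step density have equal
    integrals over all measurable subsets. *)
Lemma BV_decomposition_ramp (R : realType) (a b c s : R) v
    (C J : {charge set (measurableTypeR R) -> \bar R}) :
  0 <= c -> a <= s -> s < b -> is_BV_decomposition a b (ramp c s) v C J ->
  (forall A, measurable A -> C A = 0%E) /\
  ae_eq (@lebesgue_measure R) `]a, b[ (EFin \o v)
    (fun x => (c * \1_(`]s, b[%classic) x)%:E).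
Proof.
move=> c0 a_s sb [iv JE [N [mN N0 CN]] _ dec].
have {}JE A : measurable A -> J A = 0%E.
  by move=> mA; rewrite JE// jump_set_ramp// setI0 charge0.
have mv : measurable_fun `]a, b[ (EFin \o v) by exact: measurable_int iv.
have C0 A : measurable A -> C A = 0%E.
  move=> mA; rewrite CN//; have mAN : measurable (A `&` N) by exact: measurableI.
  have leb0 (S : set (measurableTypeR R)) :
      measurable S -> S `<=` N -> (@lebesgue_measure R) S = 0%E.
    move=> mS SN; apply/eqP; rewrite -measure_le0 -N0.
    by apply: le_measure; rewrite ?inE.
  have := dec _ mAN; rewrite D_ramp// JE// adde0 leb0; last 2 first.
  - by apply: measurableI.
  - by move=> x [[]].
  rewrite mule0 null_set_integral ?add0e//.
  - by apply: measurableI.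
  - by apply: measurable_funS mv => //; exact: subIsetr.
  - by apply: leb0; [exact: measurableI|move=> x [[]]].
split=> //; apply: integral_ae_eq => //.
  apply/measurable_EFinP; exact: measurable_funM.
move=> E EI mE; have := dec _ mE; rewrite D_ramp// JE// C0// !adde0 (setIidl EI) => <-.
under eq_integral do rewrite EFinM.
rewrite ge0_integralZl_EFin//; first by rewrite integral_indic// setIC.
exact/measurable_EFinP/measurable_indic.
Qed.

Lemma nonlinear_TV_ge0 (R : realType) (a b : R) (phi theta u : R -> R) :
  (forall t, 0 <= t -> 0 <= phi t) -> (forall t, 0 <= t -> 0 <= theta t) ->
  (0 <= nonlinear_TV a b phi theta u)%E.
Proof.
move=> phi0 theta0; rewrite /nonlinear_TV; apply: adde_ge0; first apply: adde_ge0 => //.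
- by apply: integral_ge0 => x _; rewrite lee_fin phi0.
- by apply: esum_ge0 => x _; rewrite lee_fin theta0.
Qed.

(** An upper bound is enough for a competitor, and it spares proving that a decomposition exists:
    the default triple would cost only [phi 0 = 0]. *)
Lemma nonlinear_TV_ramp_le (R : realType) (a b c s : R) (phi theta : R -> R) :
  (forall t, 0 <= t -> 0 <= phi t) ->
  {in `[0, +oo[ &, nondecreasing_fun phi} -> phi 0 = 0 ->
  0 <= c -> a <= s -> s < b ->
  (nonlinear_TV a b phi theta (ramp c s) <= ((b - s) * phi c)%:E)%E.
Proof.
move=> phi_ge0 ndphi phi0 c0 a_s sb.
(* Monotonicity of [phi] is known on the half-line only; composing with the positive part makes it
   global, hence gives measurability. *)
have mphi : measurable_fun setT (fun t : R => phi (Num.max t 0)).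
  apply: nondecreasing_measurable => // x y xy; apply: ndphi.
  - by rewrite inE/= in_itv/= andbT le_max lexx orbT.
  - by rewrite inE/= in_itv/= andbT le_max lexx orbT.
  - by rewrite ge_max !le_max xy lexx !orbT.
have phiE (t : R) : phi `|t| = phi (Num.max `|t| 0) by rewrite max_l.
have SI : `]s, b[ `<=` `]a, b[%classic by apply: subset_itvr; rewrite bnd_simp.
have int_phi : (\int[@lebesgue_measure R]_(x in `]a, b[)
    (phi `|c * \1_(`]s, b[%classic) x|)%:E = ((b - s) * phi c)%:E)%E.
  transitivity (\int[@lebesgue_measure R]_(x in `]a, b[)
      ((phi c)%:E * (\1_(`]s, b[%classic) x)%:E))%E.
    apply: eq_integral => x _; rewrite -EFinM indicE; congr EFin.
    case: (_ \in _); first by rewrite !mulr1 ger0_norm.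
    by rewrite !mulr0 normr0.
  rewrite ge0_integralZl_EFin ?phi_ge0//; last first.
    exact/measurable_EFinP/measurable_indic.
  rewrite integral_indic//= (setIidl SI) lebesgue_measure_itv/= lte_fin sb.
  by rewrite -EFinB -EFinM mulrC.
have [CE vE] : abs_charge (cantor_part a b (ramp c s)) `]a, b[ = 0%E /\
    (\int[@lebesgue_measure R]_(x in `]a, b[)
      (phi `|ac_density a b (ramp c s) x|)%:E <= ((b - s) * phi c)%:E)%E.
  rewrite /cantor_part /ac_density /BV_decomposition /pick_or.
  case: pselect => [ex|_]; last first.
    split=> /=; first by rewrite abs_charge_nonneg.
    under eq_integral do rewrite normr0 phi0.
    by rewrite integral0 lee_fin mulr_ge0 ?subr_ge0 ?(ltW sb)// phi_ge0.
  case: (cid ex) => -[[v C] J] /= dec.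
  have iv := ac_integrable dec; have [C0 vE] := BV_decomposition_ramp c0 a_s sb dec.
  split; first by rewrite abs_charge_nonneg ?C0// => A mA; rewrite C0.
  rewrite -int_phi le_eqVlt; apply/orP; left; apply/eqP.
  have mcomp (w : R -> R) : measurable_fun `]a, b[ w ->
      measurable_fun `]a, b[ (fun x => (phi `|w x|)%:E).
    move=> mw; apply/measurable_EFinP.
    rewrite (_ : (fun x => phi `|w x|) =
        (fun t => phi (Num.max t 0)) \o (fun x => `|w x|)).
      by apply: (measurableT_comp mphi); exact: measurableT_comp.
    by apply/funext => x /=; rewrite -phiE.
  apply: ge0_ae_eq_integral => //.
  - apply: mcomp; apply/measurable_EFinP; exact: measurable_int iv.
  - by apply: mcomp; apply: measurable_funM => //; exact: measurable_indic.
  - by move=> x _; rewrite lee_fin phi_ge0.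
  - by move=> x _; rewrite lee_fin phi_ge0.
  - apply: (@filterS _ _ (ae_filter_ringOfSetsType _) _ _ _ vE) => x + Ix.
    by move=> /(_ Ix) [->].
rewrite /nonlinear_TV CE jump_set_ramp// esum_set0 !adde0//.
Qed.

(** On []a, b[] the ramp is bounded by its height [c (b - s)] and supported on a piece of length
    [b - s]. *)
Lemma Lp_norm_ramp_le (R : realType) (a b c s p : R) :
  0 <= c -> a <= s -> s < b -> 1 <= p ->
  (Lp_norm a b p (ramp c s) <= (c * (b - s) * (b - s) `^ p^-1)%:E)%E.
Proof.
move=> c0 a_s sb p1; have p0 : 0 < p by exact: lt_le_trans p1.
have bs0 : 0 <= b - s by rewrite subr_ge0 ltW.
have e0 : 0 <= c * (b - s) by rewrite mulr_ge0.
pose f : R -> \bar R := (EFin \o ramp c s) \_ `]a, b[.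
have mf : measurable_fun setT f.
  apply: (measurable_restrictT (EFin \o ramp c s) (measurable_itv _)).1.
  apply: measurable_funTS; apply/measurable_EFinP.
  by apply: continuous_measurable_fun; exact: continuous_ramp.
have f_le x : (`|f x| `^ p <= ((c * (b - s)) `^ p)%:E * (\1_(`]s, b[%classic) x)%:E)%E.
  rewrite /f patchE indicE; case: ifPn => [|_]; last first.
    by rewrite abse0 poweR0r ?gt_eqF// mule_ge0// lee_fin ?powR_ge0.
  rewrite inE/= in_itv/= => /andP[ax xb].
  have [xs|sx] := leP x s.
    by rewrite ramp_le//= normr0 powR0 ?gt_eqF// mule_ge0// lee_fin ?powR_ge0.
  rewrite mem_set/= ?in_itv/= ?sx// -EFinM mulr1 lee_fin.
  apply: ge0_ler_powR; rewrite ?nnegrE//; first exact: ltW.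
  rewrite ramp_ge ?(ltW sx)// ger0_norm ?mulr_ge0 ?subr_ge0 ?(ltW sx)//.
  by rewrite ler_wpM2l// lerD2r ltW.
have int_le : (\int[@lebesgue_measure R]_x (`|f x| `^ p) <=
    ((c * (b - s)) `^ p * (b - s))%:E)%E.
  apply: (@le_trans _ _ (\int[@lebesgue_measure R]_x
      (((c * (b - s)) `^ p)%:E * (\1_(`]s, b[%classic) x)%:E))%E).
    apply: ge0_le_integral => //.
    - by move=> x _; exact: poweR_ge0.
    - apply: (measurableT_comp (measurable_poweR p)).
      exact: measurableT_comp.
    - by apply: measurable_funeM; exact/measurable_EFinP/measurable_indic.
  rewrite ge0_integralZl_EFin ?powR_ge0//; last first.
    exact/measurable_EFinP/measurable_indic.
  by rewrite integral_indic//= setIT lebesgue_measure_itv/= lte_fin sb -EFinB -EFinM.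
rewrite /Lp_norm unlock -/f.
apply: (@le_trans _ _ ((((c * (b - s)) `^ p * (b - s))%:E) `^ p^-1)%E).
  apply: gt0_ler_poweR => //.
  - by rewrite invr_ge0 ltW.
  - by rewrite in_itv/= leey andbT; apply: integral_ge0 => x _; exact: poweR_ge0.
  - by rewrite in_itv/= leey andbT lee_fin mulr_ge0// powR_ge0.
rewrite poweR_EFin lee_fin powRM ?powR_ge0// -powRrM mulfV ?gt_eqF//.
by rewrite powRr1.
Qed.

(** * Comparison of a small ramp with the zero function *)

Theorem proposition4p11 (R : realType) (phi theta : R -> R)
    (phi_ge0 : forall t, 0 <= t -> 0 <= phi t)
    (theta_ge0 : forall t, 0 <= t -> 0 <= theta t)
    (phi_nondecreasing : {in `[0, +oo[ &, nondecreasing_fun phi})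
    (theta_nondecreasing : {in `[0, +oo[ &, nondecreasing_fun theta})
    (phi_convex : convex_function (`[0, +oo[%classic : set R^o) phi)
    (theta_concave : convex_function (`[0, +oo[%classic : set R^o) (\- theta))
    (phi0 : phi 0 = 0) (theta0 : theta 0 = 0)
    (phi_infty : phi t / t @[t --> +oo] --> (1 : R))
    (theta_zero : theta t / t @[t --> 0^'+] --> (1 : R))
    (L H p gamma : R) (L_gt0 : 0 < L) (H_gt0 : 0 < H)
    (p_ge1 : 1 <= p) (gamma_ge1 : 1 <= gamma)
    (slopes : right_derivative phi 0 < left_derivative theta H)
    (lambda : R) (lambda_gt0 : 0 < lambda) :
  ~ local_minimizer_BV 0 L
      [set u | BV 0 L u /\ right_limit 0 L u 0 = 0]
      (penalized_TV phi theta L H p gamma lambda)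
      (cst 0).
Proof.
move=> [d0 d0_gt0 min0].
(* Of the four quarters of the slope gap, one pays for the excess of [phi h / h] over its limit and
   one for the penalization; the other two remain as gain. *)
have q0 : 0 < (left_derivative theta H - right_derivative phi 0) / 4.
  by rewrite divr_gt0// subr_gt0.
set eta := _ / 4 in q0.
have etaE : left_derivative theta H = right_derivative phi 0 + 4 * eta.
  by rewrite /eta; lra.
have p_gt0 : 0 < p by exact: lt_le_trans p_ge1.
(* The bounds serve in turn to keep the ramp inside the interval, to have [e <= h] and
   [delta^(1/p) <= 1], and to get [lambda delta^(1/p) <= eta]. *)
pose delta := Num.min (Num.min L 1) ((eta / lambda) `^ p).
have delta0 : 0 < delta by rewrite !lt_min L_gt0 ltr01 powR_gt0// divr_gt0.
have delta1 : delta <= 1 by rewrite /delta !ge_min lexx orbT.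
have deltaL : delta <= L by rewrite /delta !ge_min lexx.
have delta_eta : delta `^ p^-1 <= eta / lambda.
  rewrite -[leRHS](powRr1 (ltW (divr_gt0 q0 lambda_gt0))) -(mulfV (lt0r_neq0 p_gt0)).
  rewrite powRrM; apply: ge0_ler_powR.
  - by rewrite invr_ge0 ltW.
  - by rewrite nnegrE ltW.
  - by rewrite nnegrE powR_ge0.
  - by rewrite /delta ge_min lexx orbT.
(* With [delta] fixed, [h] is free to shrink. Since [e <= h], these bounds give [e < 1], [H - e > 0]
   and a BV norm, at most [2 e], below [d0]. *)
have [h [h0 h1 hH hd0 hphi]] : exists h, [/\ 0 < h, h < 1, h < H, h < d0 / 2 &
    phi h / h < right_derivative phi 0 + eta].
  have cphi := cvg_right_derivative0 phi_convex phi0 phi_ge0.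
  near (0 : R)^'+ => h; exists h; split.
  - by near: h; exact: nbhs_right_gt.
  - by near: h; exact: nbhs_right_lt.
  - by near: h; exact: nbhs_right_lt.
  - by near: h; apply: nbhs_right_lt; rewrite divr_gt0.
  - near: h; apply: (cvgr_lt _ cphi); by rewrite ltrDl.
pose e := h * delta.
have e0 : 0 < e by rewrite mulr_gt0.
have eh : e <= h by rewrite ler_piMr// ltW.
have s0 : 0 <= L - delta by rewrite subr_ge0.
have sL : L - delta < L by rewrite gtrBl.
have LsE : L - (L - delta) = delta by lra.
have F0_ge : ((theta H)%:E <= penalized_TV phi theta L H p gamma lambda (cst 0%R))%E.
  have -> : cst 0 = ramp 0 0 :> (R -> R) by apply/funext => x; rewrite /ramp mul0r.
  rewrite /penalized_TV left_limit_ramp ?L_gt0 ?lexx//.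
  rewrite [ramp 0 0 L]/ramp mul0r subr0 (gtr0_norm H_gt0).
  rewrite addeAC; apply: leeDr; apply: adde_ge0.
    exact: nonlinear_TV_ge0.
  by rewrite mule_ge0 ?lee_fin ?(ltW lambda_gt0)// poweR_ge0.
have uA : [set u | BV 0 L u /\ right_limit 0 L u 0 = 0] (ramp h (L - delta)).
  split; first by apply: BV_ramp => //; exact: ltW.
  by rewrite right_limit_ramp ?lexx ?L_gt0 ?(ltW h0)// ramp_le.
have u0_small : (BV_norm 0 L (ramp h (L - delta) \- cst 0)%R < d0%:E)%E.
  have -> : (ramp h (L - delta) \- cst 0)%R = ramp h (L - delta).
    by apply/funext => x /=; rewrite subr0.
  rewrite /BV_norm abs_charge_D_ramp ?(ltW h0)// LsE -/e.
  (* The L^1 norm is at most [e delta <= e], and the total variation equals [e]. *)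
  apply: (@le_lt_trans _ _ (e%:E + e%:E)%E).
    apply: leeD => //.
    apply: le_trans (Lp_norm_ramp_le (ltW h0) s0 sL (lexx _)) _.
    by rewrite LsE -/e invr1 powRr1 ?(ltW delta0)// lee_fin ler_piMr// ltW.
  by rewrite -EFinD lte_fin; lra.
have {min0 uA u0_small}/(le_trans F0_ge) := min0 _ uA u0_small.
apply/negP; rewrite -ltNge.
rewrite /penalized_TV left_limit_ramp ?L_gt0 ?lexx ?(ltW h0)//.
rewrite ramp_ge ?(ltW sL)// LsE -/e (gtr0_norm (x := H - e)); last first.
  by rewrite subr_gt0 (le_lt_trans eh).
have TVle := nonlinear_TV_ramp_le theta phi_ge0 phi_nondecreasing phi0 (ltW h0) s0 sL.
rewrite LsE in TVle.
have Lple : (lambda%:E * Lp_norm 0 L p (ramp h (L - delta)) `^ gamma <= (e * eta)%:E)%E.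
  have Lp1 := Lp_norm_ramp_le (ltW h0) s0 sL p_ge1.
  rewrite LsE -/e in Lp1; set N := e * _ in Lp1.
  have dp0 : 0 < delta `^ p^-1 by exact: powR_gt0.
  have N0 : 0 < N by rewrite mulr_gt0.
  have dp1 : delta `^ p^-1 <= 1.
    have -> : 1 = 1 `^ p^-1 :> R by rewrite powR1.
    apply: ge0_ler_powR; rewrite ?nnegrE//.
      by rewrite invr_ge0 ltW.
    exact: ltW.
  have N1 : N <= 1.
    rewrite -[leRHS]mulr1; apply: ler_pM => //; try exact: ltW.
    by rewrite (le_trans eh)// ltW.
  (* Since [N <= 1] and [gamma >= 1], the power [gamma] only decreases [N]. *)
  apply: (@le_trans _ _ (lambda%:E * N%:E)%E).
    apply: lee_wpmul2l; first by rewrite lee_fin ltW.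
    apply: (@le_trans _ _ (N%:E `^ gamma)%E).
      apply: gt0_ler_poweR => //; rewrite ?in_itv/= ?leey ?andbT.
      - exact: le_trans gamma_ge1.
      - exact: Lnorm_ge0.
      - by rewrite lee_fin ltW.
    by rewrite poweR_EFin lee_fin ge1r_powR// N0.
  rewrite -EFinM lee_fin /N mulrCA ler_wpM2l ?(ltW e0)//.
  by rewrite mulrC -ler_pdivlMr.
have slope := left_derivative_le theta_concave theta_nondecreasing e0 (le_lt_trans eh hH).
rewrite etaE ler_pdivlMr// in slope.
have phi_le : delta * phi h <= e * (right_derivative phi 0 + eta).
  rewrite /e mulrAC mulrC; apply: ler_wpM2r; first exact: ltW.
  by rewrite mulrC -ler_pdivrMr// ltW.
(* By [slope] and [phi_le] this sum is at most [theta H - 2 e eta]. *)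
apply: (@le_lt_trans _ _ ((delta * phi h)%:E + (theta (H - e))%:E + (e * eta)%:E)%E).
  by apply: leeD => //; apply: leeD.
rewrite -!EFinD lte_fin.
have eeta : 0 < e * eta by exact: mulr_gt0.
nra.
Unshelve. all: by end_near. Qed.
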